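(* Over the binary alphabet $V = \{a, b\}$, the language $Q_{\overline{I}}$ is not context-free.
   Context: $V^*$ is the set of all finite words over $V$. A nonempty word $w$ is primitive if it is not of the form $v^n$ for a word $v$ and an integer $n \ge 2$; $Q$ is the set of primitive words over $V$. For a word $w$ of length $n$, $w[1..i]$ denotes its prefix of length $i$ and $w[i+1..n]$ its suffix of length $n-i$. A primitive word $w$ of length $n$ is ins-robust if for every $i \in \{0,\ldots,n\}$ and every $c \in V$ the word $w[1..i]\,c\,w[i+1..n]$ is primitive; $Q_I$ is the set of ins-robust primitive words and $Q_{\overline{I}} = Q \setminus Q_I$. *)

(* Defs.v *)
(* The binary alphabet {a, b} is rendered as bool. *)
From Stdlib Require Import Relation_Operators.
From mathcomp Require Import all_boot.

Set Implicit Arguments.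
Unset Strict Implicit.
Unset Printing Implicit Defensive.

Definition language (V : Type) := seq V -> Prop.

Record cfg (V : finType) := Cfg {
  nonterminal : finType;
  start : nonterminal;
  rules : seq (nonterminal * seq (nonterminal + V))
}.

Definition cfg_step (V : finType) (G : cfg V)
    (u v : seq (nonterminal G + V)) : Prop :=
  exists (x y : seq (nonterminal G + V)) (A : nonterminal G)
         (r : seq (nonterminal G + V)),
    [/\ (A, r) \in rules G, u = x ++ inl A :: y & v = x ++ r ++ y].

Definition cfg_derives (V : finType) (G : cfg V) :
    seq (nonterminal G + V) -> seq (nonterminal G + V) -> Prop :=
  clos_refl_trans _ (@cfg_step V G).

Definition cfg_language (V : finType) (G : cfg V) : language V :=
  fun w => cfg_derives [:: inl (start G)] [seq inr c | c <- w].

Definition context_free (V : finType) (L : language V) : Prop :=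
  exists G : cfg V, forall w : seq V, L w <-> cfg_language G w.

Definition word_pow (V : Type) (v : seq V) (n : nat) : seq V :=
  flatten (nseq n v).

Definition primitive (V : Type) (w : seq V) : Prop :=
  w <> [::] /\ ~ exists (v : seq V) (n : nat), 2 <= n /\ w = word_pow v n.

Definition insert_at (V : Type) (i : nat) (c : V) (w : seq V) : seq V :=
  take i w ++ c :: drop i w.

Definition Q_I (V : Type) : language V :=
  fun w => primitive w /\
    forall (i : nat) (c : V), i <= size w -> primitive (insert_at i c w).

Definition Q_I_bar (V : Type) : language V :=
  fun w => primitive w /\ ~ Q_I w.

(* Main.v *)
(* Context-free languages can be pumped down: in a long word of the language two
   factors v, y, not both empty and contained in a factor of bounded length, can
   be deleted. Apply this to w = a^k b^k a^k b^k a^(k-1) b^k, which is primitive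
   and becomes a cube after inserting one letter a. For k large the deletion
   shortens one run or two adjacent runs, so at most one of the a-runs and at
   most one of the b-runs. If inserting a letter made the result a proper power,
   it would be the cube of a word a^X b^Y up to rotation (an insertion that splits
   a run creates a run of length one, which does not repeat), so the runs would
   have lengths X and Y with a single letter missing in total. But an a-run
   shorter than another one is already present in w, and no deletion repairs
   this without creating a second missing letter. *)
From Stdlib Require Import Relation_Operators Operators_Properties.
From mathcomp Require Import all_boot zify.
Require Import Defs.

Set Implicit Arguments.
Unset Strict Implicit.
Unset Printing Implicit Defensive.

(** * Parse forests and derivations *)

Section Pumping.

Variables (V : finType) (G : cfg V).

Local Notation N := (nonterminal G).

(* Ordered parse forests in first-child / next-sibling form, which avoids a
   nested inductive type. *)
Inductive forest :=
| FNil
| FTerm of V & forest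
| FNode of N & forest & forest.

Fixpoint yield f : seq V :=
  match f with
  | FNil => [::]
  | FTerm c f => c :: yield f
  | FNode _ g f => yield g ++ yield f
  end.

Fixpoint roots_of f : seq (N + V) :=
  match f with
  | FNil => [::]
  | FTerm c f => inr c :: roots_of f
  | FNode A _ f => inl A :: roots_of f
  end.

Fixpoint parse f : bool :=
  match f with
  | FNil => true
  | FTerm _ f => parse f
  | FNode A g f => [&& (A, roots_of g) \in rules G, parse g & parse f]
  end.

Fixpoint labels f : {set N} :=
  match f with
  | FNil => set0
  | FTerm _ f => labels f
  | FNode A g f => A |: (labels g :|: labels f)
  end.

(** Only repetitions along a downward path are excluded; siblings may share labels. *)
Fixpoint repetition_free f : bool :=
  match f with
  | FNil => true
  | FTerm _ f => repetition_free f
  | FNode A g f => [&& A \notin labels g, repetition_free g & repetition_free f]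
  end.

Definition generates (alpha : seq (N + V)) (w : seq V) : Prop :=
  exists f, [/\ parse f, roots_of f = alpha & yield f = w].

Lemma generates_terminals w : generates [seq inr c | c <- w] w.
Proof.
elim: w => [|c w [f [pf rf yf]]]; first by exists FNil.
by exists (FTerm c f); rewrite /= rf yf.
Qed.

Lemma generates_cat alpha beta v w :
  generates alpha v -> generates beta w -> generates (alpha ++ beta) (v ++ w).
Proof.
move=> [f [pf <- <-]] [g [pg <- <-]] {alpha beta v w}.
elim: f pf => [|c f IHf|A f1 _ f IHf] /=; first by exists g.
- by move=> /IHf[h [ph rh yh]]; exists (FTerm c h); rewrite /= rh yh.
- case/and3P=> rA p1 /IHf[h [ph rh yh]]; exists (FNode A f1 h).
  by rewrite /= rA p1 ph rh yh catA.
Qed.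

Lemma generates_cat_inv alpha beta w : generates (alpha ++ beta) w ->
  exists u v, [/\ w = u ++ v, generates alpha u & generates beta v].
Proof.
move=> [f [pf rf <-]] {w}.
elim: alpha f pf rf => [|s alpha IH] f pf rf.
  by exists [::], (yield f); split=> //; [exists FNil | exists f].
case: f pf rf => [//|c f|A g f] /=.
- move=> pf [<- /(IH _ pf)[u [v [-> [h [ph rh yh]] gv]]]].
  exists (c :: u), v; split=> //; exists (FTerm c h).
  by rewrite /= rh yh.
- case/and3P=> rA pg pf [<- /(IH _ pf)[u [v [-> [h [ph rh yh]] gv]]]].
  exists (yield g ++ u), v; split=> //; first by rewrite catA.
  by exists (FNode A g h); rewrite /= rA pg ph rh yh.
Qed.

Lemma generates_rule A r w :
  (A, r) \in rules G -> generates r w -> generates [:: inl A] w.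
Proof.
move=> rA [f [pf rf yf]]; exists (FNode A f FNil).
by rewrite /= rf rA pf yf cats0.
Qed.

Lemma cfg_derives_context (x y u v : seq (N + V)) :
  cfg_derives u v -> cfg_derives (x ++ u ++ y) (x ++ v ++ y).
Proof.
elim=> {u v} [u v [x' [y' [A [r [rA -> ->]]]]]|u|u v w _ IH1 _ IH2].
- apply: rt_step; exists (x ++ x'), (y' ++ y), A, r.
  by rewrite -!catA.
- exact: rt_refl.
- exact: rt_trans IH1 IH2.
Qed.

(** From right to left the derivation is read from its first step: a forest for [x ++ r ++ y] is cut
    in three and its middle part gets a root [A]. *)
Lemma generatesP alpha w :
  generates alpha w <-> cfg_derives alpha [seq inr c | c <- w].
Proof.
split.
- case=> f [pf <- <-] {alpha w}.
  elim: f pf => [|c f IHf|A g IHg f IHf] /=; first by move=> _; apply: rt_refl.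
  + move=> /IHf h; have := cfg_derives_context [:: inr c] [::] h.
    by rewrite !cats0.
  + case/and3P=> rA /IHg hg /IHf hf; rewrite map_cat.
    apply: (@rt_trans _ _ _ (roots_of g ++ roots_of f)).
      by apply: rt_step; exists [::], (roots_of f), A, (roots_of g).
    apply: (@rt_trans _ _ _ ([seq inr c | c <- yield g] ++ roots_of f)).
      exact: (cfg_derives_context [::] (roots_of f) hg).
    have := cfg_derives_context [seq inr c | c <- yield g] [::] hf.
    by rewrite !cats0.
- move=> /clos_rt_rt1n_iff; move Ew: [seq inr c | c <- w] => beta d.
  elim: d Ew => {alpha beta} [beta <-|alpha gamma beta st _ IH /IH].
    exact: generates_terminals.
  case: st => [x [y [A [r [rA -> ->]]]]].
  case/generates_cat_inv=> u [v [-> gu /generates_cat_inv[v1 [v2 [-> g1 g2]]]]].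
  apply: generates_cat gu _; rewrite -cat1s.
  exact: generates_cat (generates_rule rA g1) g2.
Qed.

(** * Pumping down in context-free languages *)

(** The successor keeps all powers of this number positive. *)
Definition rule_width : nat := (\max_(p <- rules G) size p.2).+1.

(** A repetition-free tree yields at most [rule_width ^ #|N|] letters; the extra factor allows for a
    node whose own label recurs below it. *)
Definition pumping_length : nat := rule_width ^ #|N|.+1.

Lemma size_rule A r : (A, r) \in rules G -> size r <= rule_width.
Proof.
by move=> rA; rewrite /rule_width (big_rem (A, r)) //= ltnW // ltnS leq_maxl.
Qed.

(** Descending below a node [A] replaces one root by at most [rule_width] roots and removes [A] from
    the available labels. *)
Lemma size_yield_repetition_free f (X : {set N}) :
  parse f -> repetition_free f -> labels f \subset X ->
  size (yield f) <= size (roots_of f) * rule_width ^ #|X|.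
Proof.
have K1 k : 0 < rule_width ^ k by rewrite expn_gt0.
elim: f X => [|c f IHf|A g IHg f IHf] X //=.
- move=> pf rf sX; rewrite mulSn -add1n.
  by apply: leq_add; [exact: K1 | exact: IHf].
- case/and3P=> rA pg pf /and3P[Ag rg rf]; rewrite !subUset sub1set.
  case/and3P=> AX gX fX; rewrite size_cat mulSn.
  apply: leq_add; last exact: IHf.
  have gXA : labels g \subset X :\ A by rewrite subsetD1 gX Ag.
  apply: leq_trans (IHg _ pg rg gXA) _.
  rewrite (cardsD1 A X) AX add1n expnS leq_mul2r.
  by rewrite (size_rule rA) orbT.
Qed.

Lemma size_yield_le_pumping_length A f :
  (A, roots_of f) \in rules G -> parse f -> repetition_free f ->
  size (yield f) <= pumping_length.
Proof.
move=> rA pf rf; have := size_yield_repetition_free pf rf (subsetT _).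
move/leq_trans; apply.
by rewrite cardsT /pumping_length expnS leq_mul2r (size_rule rA) orbT.
Qed.

(** An occurrence of [A] in a repetition-free forest has no [A] below it, so its children can be put
    under another [A] without a repetition. *)
Lemma repetition_free_subforest A f :
  parse f -> repetition_free f -> A \in labels f ->
  exists g v y, [/\ (A, roots_of g) \in rules G, parse g,
    A \notin labels g, repetition_free g & yield f = v ++ yield g ++ y].
Proof.
elim: f => [|c f IHf|B g IHg f IHf] /=; first by rewrite inE.
- move=> pf rf /(IHf pf rf)[h [v [y [rA ph Ah rh ->]]]].
  by exists h, (c :: v), y.
- case/and3P=> rB pg pf /and3P[Bg rg rf]; rewrite !inE => /or3P[/eqP ->|Ag|Af].
  + by exists g, [::], (yield f).
  + have [h [v [y [rA ph Ah rh ->]]]] := IHg pg rg Ag.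
    by exists h, v, (y ++ yield f); rewrite -!catA.
  + have [h [v [y [rA ph Ah rh ->]]]] := IHf pf rf Af.
    by exists h, (yield g ++ v), y; rewrite -!catA.
Qed.

Definition pumps_down (alpha : seq (N + V)) (w : seq V) : Prop :=
  exists u v x y z, [/\ w = u ++ v ++ x ++ y ++ z,
    size (v ++ x ++ y) <= pumping_length, 0 < size (v ++ y) &
    generates alpha (u ++ x ++ z)].

Lemma pumps_down_context alpha beta gamma u v w :
  generates alpha u -> pumps_down beta v -> generates gamma w ->
  pumps_down (alpha ++ beta ++ gamma) (u ++ v ++ w).
Proof.
move=> gu [u1 [v1 [x1 [y1 [z1 [-> le1 gt1 g1]]]]]] gw.
exists (u ++ u1), v1, x1, y1, (z1 ++ w); split=> //; first by rewrite -!catA.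
have := generates_cat gu (generates_cat g1 gw).
by rewrite -!catA.
Qed.

Lemma pumps_down_rule A r w :
  (A, r) \in rules G -> pumps_down r w -> pumps_down [:: inl A] w.
Proof.
move=> rA [u [v [x [y [z [-> le1 gt1 g1]]]]]].
by exists u, v, x, y, z; split=> //; apply: generates_rule g1.
Qed.

(* If the subforest found below a repeated [A] has the same yield as the whole,
   it may replace it; otherwise this replacement pumps down. *)
Lemma repetition_free_or_pumps_down f : parse f ->
  (exists g, [/\ parse g, repetition_free g, roots_of g = roots_of f &
     yield g = yield f])
  \/ pumps_down (roots_of f) (yield f).
Proof.
elim: f => [|c f IHf|A g IHg f IHf] /=; first by left; exists FNil.
- move=> pf; have [[h [ph fh rh yh]]|pd] := IHf pf.
    by left; exists (FTerm c h); rewrite /= rh yh.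
  right; have := pumps_down_context (generates_terminals [:: c]) pd
    (generates_terminals [::]).
  by rewrite /= !cats0.
- case/and3P=> rA pg pf.
  have gf : generates (roots_of f) (yield f) by exists f.
  have [[g' [pg' fg' rg' yg']]|pd] := IHg pg; last first.
    right; have := pumps_down_context (generates_terminals [::])
      (pumps_down_rule rA pd) gf.
    by [].
  have [[f' [pf' ff' rf' yf']]|pd] := IHf pf; last first.
    have gA : generates [:: inl A] (yield g).
      by apply: (generates_rule rA); exists g.
    right; have := pumps_down_context gA pd (generates_terminals [::]).
    by rewrite /= !cats0.
  (* Both parts are now repetition-free, so only the root [A] can recur below itself. *)
  have [Ag'|Ag'] := boolP (A \in labels g'); last first.
    left; exists (FNode A g' f').
    by rewrite /= rg' rA pg' pf' Ag' fg' ff' rf' yg' yf'.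
  have [h [v [y [rh ph Ah fh yh]]]] := repetition_free_subforest pg' fg' Ag'.
  have [vy0|vy] := posnP (size (v ++ y)).
    left; exists (FNode A h f').
    move: vy0 yh; rewrite size_cat; case: v => //; case: y => // _.
    rewrite cats0 /= => yh.
    by rewrite rh ph pf' Ah fh ff' rf' yf' -yg' yh.
  right; exists [::], v, (yield h), y, (yield f); split=> //.
  + by rewrite -yg' yh -!catA.
  + by rewrite -yh; apply: (@size_yield_le_pumping_length A); rewrite ?rg'.
  + have gA : generates [:: inl A] (yield h).
      by apply: (generates_rule rh); exists h.
    exact: (generates_cat gA gf).
Qed.

(** Otherwise the word has a repetition-free tree, whose yield is too short. *)
Lemma cfg_pump_down w :
  cfg_language G w -> pumping_length < size w ->
  exists u v x y z, [/\ w = u ++ v ++ x ++ y ++ z,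
    size (v ++ x ++ y) <= pumping_length, 0 < size (v ++ y) &
    cfg_language G (u ++ x ++ z)].
Proof.
move=> /generatesP[f [pf rf yf]] ltw.
have [[g [pg fg rg yg]]|] := repetition_free_or_pumps_down pf; last first.
  rewrite rf yf => -[u [v [x [y [z [-> le1 gt1 /generatesP g1]]]]]].
  by exists u, v, x, y, z.
have := size_yield_repetition_free pg fg (subsetT _).
rewrite rg rf yg yf mul1n cardsT => lew.
move: (leq_trans ltw lew); rewrite /pumping_length expnS.
by rewrite mulSn ltnNge leq_addr.
Qed.

End Pumping.

(** * Factorizations of runs and powers of words *)

Section Blocks.

Variable T : Type.

Lemma cat_eq_nseq_cat (c : T) n (u r R : seq T) :
  u ++ r = nseq n c ++ R ->
  (size u <= n /\ u = nseq (size u) c /\ r = nseq (n - size u) c ++ R)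
  \/ exists d u', u = nseq n c ++ d :: u' /\ (d :: u') ++ r = R.
Proof.
elim: n u => [|n IH] [|d u] /=; try by left.
  by move=> <-; right; exists d, u.
case=> -> /IH[[le1 [-> ->]]|[e [u' [-> eqR]]]].
  by left; rewrite size_nseq ltnS le1.
by right; exists e, u'.
Qed.

Lemma cat_eq_nseq (c : T) n (u v : seq T) :
  u ++ v = nseq n c ->
  [/\ size u + size v = n, u = nseq (size u) c & v = nseq (size v) c].
Proof.
elim: n u => [|n IH] [|d u] //=; first by case: v.
  by move=> ->; rewrite /= size_nseq.
by case=> -> /IH[<- <- <-].
Qed.

Lemma infix_nseq_cat_nseq (c d : T) m n (v x y : seq T) :
  v ++ x ++ y = nseq m c ++ nseq n d ->
  exists i j, [/\ i <= m, j <= n & x = nseq i c ++ nseq j d].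
Proof.
move/cat_eq_nseq_cat=> [[lev [_]]|[e [v' [_ /cat_eq_nseq[sv _ exy]]]]].
  move/cat_eq_nseq_cat=> [[lex [ex _]]|[e [x' [-> ex']]]].
    by exists (size x), 0; rewrite cats0 -ex; split=> //; lia.
  have [sx -> _] := cat_eq_nseq ex'.
  by exists (m - size v), (size (e :: x')); split=> //; lia.
have [sx -> _] := cat_eq_nseq exy.
by exists 0, (size x); split=> //; lia.
Qed.

(** The factor [v ++ x ++ y] starts in the first run and is too short to reach beyond the second. *)
Lemma delete_from_two_blocks (c d : T) m n (v x y z R : seq T) :
  size (v ++ x ++ y) <= n ->
  v ++ x ++ y ++ z = nseq m c ++ nseq n d ++ R ->
  exists i j, [/\ i <= m, j <= n & x ++ z = nseq i c ++ nseq j d ++ R].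
Proof.
move=> let_n; rewrite (_ : v ++ _ = (v ++ x ++ y) ++ z); last by rewrite -!catA.
move/cat_eq_nseq_cat=> [[le_m [et ->]]|[e [t [et]]]].
  have [sv _ exy] := cat_eq_nseq et; have [sx ex _] := cat_eq_nseq exy.
  exists (size x + (m - size (v ++ x ++ y))), n.
  by rewrite nseqD -catA -ex; split=> //; lia.
have st : size (e :: t) <= n.
  by move: let_n; rewrite et size_cat; lia.
move/cat_eq_nseq_cat=> [[_ [et' ->]]|[e' [t' [et' _]]]]; last first.
  by move: st; rewrite et' size_cat size_nseq /=; lia.
rewrite et' in et.
have [i [j [le_i le_j ->]]] := infix_nseq_cat_nseq et.
exists i, (j + (n - size (e :: t))).
by rewrite nseqD -!catA; split=> //; lia.
Qed.

Lemma nseq_cat_inj (c : T) m n (u v : seq T) :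
  ohead u <> Some c -> ohead v <> Some c ->
  nseq m c ++ u = nseq n c ++ v -> m = n /\ u = v.
Proof.
elim: m n => [|m IH] [|n] //= hu hv; first by move=> eu; rewrite eu in hu.
  by move=> ev; rewrite -ev in hv.
by case=> /(IH _ hu hv)[-> ->].
Qed.

Lemma word_powS (v : seq T) n : word_pow v n.+1 = v ++ word_pow v n.
Proof. by []. Qed.

Lemma word_powSr (v : seq T) n : word_pow v n.+1 = word_pow v n ++ v.
Proof.
elim: n => [|n IH]; first by rewrite word_powS cats0.
by rewrite word_powS {1}IH catA -word_powS.
Qed.

Lemma word_pow_nil n : word_pow (@nil T) n = [::].
Proof. by elim: n. Qed.

Lemma size_word_pow (v : seq T) n : size (word_pow v n) = n * size v.
Proof. by elim: n => // n IH; rewrite word_powS size_cat IH mulSn. Qed.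

Lemma word_pow_rot (c : T) v n :
  c :: word_pow (rcons v c) n = rcons (word_pow (c :: v) n) c.
Proof.
elim: n => // n IH.
by rewrite !word_powS cat_rcons IH rcons_cat.
Qed.

End Blocks.

(** * Deleting a short factor from a word given by run lengths *)

(** Runs of length zero are allowed, so that a deletion keeps the number of entries. *)
Fixpoint blocks (c : bool) (es : seq nat) : seq bool :=
  if es is e :: es' then nseq e c ++ blocks (~~ c) es' else [::].

Lemma size_blocks c es : size (blocks c es) = sumn es.
Proof. by elim: es c => //= e es IH c; rewrite size_cat size_nseq IH. Qed.


(* [adjacent_le es fs]: [es] arises from [fs] by lowering at most two entries,
   which must be adjacent. *)
Fixpoint adjacent_le (es fs : seq nat) : bool :=
  match es, fs with
  | e1 :: es1, f1 :: fs1 =>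
      (e1 == f1) && adjacent_le es1 fs1 ||
      (e1 <= f1) &&
      match es1, fs1 with
      | e2 :: es2, f2 :: fs2 => (e2 <= f2) && (es2 == fs2)
      | _, _ => es1 == fs1
      end
  | _, _ => es == fs
  end.

Lemma adjacent_le_size es fs : adjacent_le es fs -> size es = size fs.
Proof.
elim: es fs => [|e1 es IH] [|f1 fs] //= /orP[/andP[_ /IH -> //]|/andP[_]].
by case: es fs {IH} => [|e2 es] [|f2 fs] // /andP[_ /eqP ->].
Qed.

(** Every run is at least as long as the factor, so the factor ends at the latest in the run after
    the one where it starts. *)
Lemma delete_from_blocks c es u v x y z :
  u ++ v ++ x ++ y ++ z = blocks c es ->
  all (fun e => size (v ++ x ++ y) <= e) es ->
  exists fs, adjacent_le fs es /\ u ++ x ++ z = blocks c fs.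
Proof.
elim: es c u => [|e es IH] c u /=.
  by case: u v x y z => [|? ?] [|? ?] [|? ?] [|? ?] [|? ?] // _ _; exists [::].
move=> eu /andP[_ les].
have [[le_u [u_c eR]]|[d [u' [-> eR]]]] := cat_eq_nseq_cat eu; last first.
  have [fs [afs efs]] := IH _ _ eR les.
  by exists (e :: fs); rewrite /= eqxx afs -efs -catA.
case: es les eR {IH eu} => [_|f es /andP[le_f _]] /=.
  rewrite cats0 => e1; have [s1 _ e2] := cat_eq_nseq e1.
  have [s2 x_c e3] := cat_eq_nseq e2; have [s3 _ z_c] := cat_eq_nseq e3.
  exists [:: size u + (size x + size z)]; split; first by rewrite /= eqxx; lia.
  by rewrite /= cats0 !nseqD -u_c -x_c -z_c.
move/(delete_from_two_blocks le_f)=> [i [j [le_i le_j ->]]].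
exists [:: size u + i, j & es]; split; last by rewrite /= nseqD -u_c -catA.
by rewrite /= eqxx; lia.
Qed.

(** * Coding words that start with a and end with b *)

(* The word [a^(x1+1) b^(y1+1) a^(x2+1) b^(y2+1) ...], with [a = true]. *)
Fixpoint ab_word (s : seq (nat * nat)) : seq bool :=
  if s is (x, y) :: s' then
    nseq x.+1 true ++ nseq y.+1 false ++ ab_word s'
  else [::].

Lemma ab_word_cons x y s :
  ab_word ((x, y) :: s) = nseq x.+1 true ++ nseq y.+1 false ++ ab_word s.
Proof. by []. Qed.

Lemma ab_word_cat s t : ab_word (s ++ t) = ab_word s ++ ab_word t.
Proof. by elim: s => // -[x y] s IH; rewrite !ab_word_cons IH -!catA. Qed.

Lemma ab_word_pow s n : ab_word (word_pow s n) = word_pow (ab_word s) n.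
Proof. by elim: n => // n IH; rewrite !word_powS ab_word_cat IH. Qed.

(** The shift by one makes all runs nonempty, so the word determines their boundaries. *)
Lemma ab_word_inj : injective ab_word.
Proof.
have hd s : ohead (ab_word s) <> Some false by case: s => [|[x y] s].
elim=> [|[x y] s IH] [|[x' y'] t] //.
case/(@nseq_cat_inj _ true x.+1 x'.+1)=> // -[->].
by case/(@nseq_cat_inj _ false y.+1 y'.+1)=> // -[->] /IH ->.
Qed.

Lemma ab_word_suffix u : last false u = false ->
  exists k s, u = nseq k false ++ ab_word s.
Proof.
elim: u => [|[] u IH] /=; first by exists 0, [::].
- case: u IH => // c u IH lu; have [[|k] [s es]] := IH lu.
    by case: s es => [|[x y] s] // ->; exists 0, ((x.+1, y) :: s).
  by rewrite es; exists 0, ((0, k) :: s).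
- by move/IH=> [k [s ->]]; exists k.+1, s.
Qed.

Lemma ab_word_surj u :
  ohead u = Some true -> last false u = false -> exists s, u = ab_word s.
Proof.
by move=> hu /ab_word_suffix[[|k] [s eu]]; [exists s | move: hu; rewrite eu].
Qed.

Lemma last_ab_word c p s : last c (ab_word (p :: s)) = false.
Proof.
elim: s c p => [|q s IH] c [x y].
  by rewrite /= cats0 last_cat /= -(cats0 (nseq _ _)); elim: y.
by rewrite -cat1s ab_word_cat last_cat IH.
Qed.

(** The root [u] starts with a and ends with b like the whole word, so it has a code too, and
    injectivity transfers the equation. *)
Lemma ab_word_eq_pow s u n : 0 < size s -> 1 < n ->
  ab_word s = word_pow u n -> exists t, s = word_pow t n.
Proof.
case: n => [|n] // s0 _ e.
have u0 : u <> [::].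
  by move=> u0; move: s0 e; rewrite u0 word_pow_nil; case: s => [|[]].
have [t et] : exists t, u = ab_word t.
  apply: ab_word_surj.
    by move: s0 e; case: s => [|[x y] s] // _; case: u u0 => //= c u _ [<-].
  case: s s0 e => // p s _ e; rewrite -(last_ab_word false p s) e word_powSr.
  by rewrite last_cat; case: u u0 {e}.
by exists t; apply: ab_word_inj; rewrite ab_word_pow -et.
Qed.

(** * Inserting a letter, seen on codes *)

(** A run grows by one letter, or a run of length i+j+2 is split into runs of lengths i+1 and j+1 by
    a new run of length one, coded as 0. *)
Inductive code_insertion : seq (nat * nat) -> seq (nat * nat) -> Prop :=
| code_insertion_a x y s : code_insertion ((x, y) :: s) ((x.+1, y) :: s)
| code_insertion_b x y s : code_insertion ((x, y) :: s) ((x, y.+1) :: s)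
| code_insertion_split_a i j y s :
    code_insertion (((i + j).+1, y) :: s) [:: (i, 0), (j, y) & s]
| code_insertion_split_b x i j s :
    code_insertion ((x, (i + j).+1) :: s) [:: (x, i), (0, j) & s]
| code_insertion_cons p s t :
    code_insertion s t -> code_insertion (p :: s) (p :: t).

(** Only a b in front or an a at the end destroys the coded shape; the other cases follow from the
    run in which the cut lies. *)
Lemma insert_ab_word s l c r : l ++ r = ab_word s ->
  [\/ l ++ c :: r = false :: ab_word s, l ++ c :: r = rcons (ab_word s) true |
    exists t, code_insertion s t /\ l ++ c :: r = ab_word t].
Proof.
elim: s l => [|[x y] s IH] l.
  by case: l r => [|? ?] [|? ?] //= _; case: c; [apply: Or32 | apply: Or31].
case/(@cat_eq_nseq_cat _ true x.+1)=> [[lel [el ->]]|[d [l' [->]]]].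
  move: (size l) lel el => i lel -> {IH l}; case: c.
    apply: Or33; exists ((x.+1, y) :: s); split; first exact: code_insertion_a.
    rewrite -cat_rcons -[rcons _ _]cats1 -[[:: true]]/(nseq 1 true) -nseqD catA.
    by rewrite -nseqD (_ : _ + _ = x.+2) //; lia.
  case: i lel => [_|i]; first by rewrite subn0; apply: Or31.
  rewrite ltnS leq_eqVlt => /predU1P[->|lt_ix].
    rewrite subnn; apply: Or33.
    by exists ((x, y.+1) :: s); split; first exact: code_insertion_b.
  apply: Or33; exists [:: (i, 0), (x - i.+1, y) & s]; split.
    rewrite {1}(_ : x = (i + (x - i.+1)).+1); last by lia.
    exact: code_insertion_split_a.
  by rewrite /= subSS (_ : x - i = (x - i.+1).+1) //; lia.
case/(@cat_eq_nseq_cat _ false y.+1)=> [[lel [el ->]]|[d' [l'' [-> /IH H]]]].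
  move: el lel; rewrite [size _]/= => ->; move: (size l') => j lel {IH}; case: c.
    move: lel; rewrite ltnS leq_eqVlt => /predU1P[->|lt_jy].
      (* An a after the b-run joins the next a-run, or ends the word if there is none. *)
      rewrite subnn; case: s => [|[x' y'] s].
        by apply: Or32; rewrite ab_word_cons -cats1 -!catA.
      apply: Or33; exists [:: (x, y), (x'.+1, y') & s].
      split; first by do 2 constructor.
      by rewrite !ab_word_cons -!catA.
    apply: Or33; exists [:: (x, j), (0, y - j.+1) & s]; split.
      rewrite {1}(_ : y = (j + (y - j.+1)).+1); last by lia.
      exact: code_insertion_split_b.
    rewrite !ab_word_cons subSS (_ : y - j = (y - j.+1).+1); last by lia.
    by rewrite -!catA.
  apply: Or33; exists ((x, y.+1) :: s); split; first exact: code_insertion_b.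
  rewrite -catA; congr (_ ++ _).
  rewrite -cat_rcons -[rcons _ _]cats1 -[[:: false]]/(nseq 1 false) -nseqD catA.
  by rewrite -nseqD (_ : _ + _ = y.+2) //; lia.
rewrite -!catA; case: H => [->|->|[t [ct ->]]].
- apply: Or33; exists ((x, y.+1) :: s); split; first exact: code_insertion_b.
  rewrite -cat_rcons -[rcons _ _]cats1 -[[:: false]]/(nseq 1 false).
  by rewrite -nseqD addn1.
- by apply: Or32; rewrite -!rcons_cat.
- by apply: Or33; exists ((x, y) :: t); split; first exact: code_insertion_cons.
Qed.

Lemma code_insertion_last s x y :
  code_insertion (rcons s (x, y)) (rcons s (x, y.+1)).
Proof. by elim: s => [|p s IH] /=; constructor. Qed.

Lemma word_pow_eq_cons (T : Type) (c : T) w u n :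
  c :: w = word_pow u n -> exists v, rcons w c = word_pow v n.
Proof.
case: u => [|d u]; first by rewrite word_pow_nil.
case: n => // n e; have ecd : c = d by case: e.
have := word_pow_rot d u n.+1; rewrite -e -ecd => -[ew].
by exists (rcons u c); rewrite ew.
Qed.

Lemma word_pow_eq_rcons (T : Type) (c : T) w u n :
  rcons w c = word_pow u n -> exists v, c :: w = word_pow v n.
Proof.
case/lastP: u => [|u d]; first by rewrite word_pow_nil; case: w.
case: n => [|n e]; first by case: w.
have ecd : c = d.
  by move: (congr1 (last c) e); rewrite word_powSr last_cat !last_rcons.
exists (c :: u); apply: (@rcons_injl _ c).
by rewrite -word_pow_rot rcons_cons e ecd.
Qed.

(* A letter added at one end of the word can be rotated to the other end. *)
Lemma insert_ab_word_eq_pow s l c r u n : 0 < size s -> 1 < n ->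
  l ++ r = ab_word s -> l ++ c :: r = word_pow u n ->
  exists t, code_insertion s (word_pow t n).
Proof.
move=> s0 n1 elr eu.
suff [t [v [ct ev]]] : exists t v, code_insertion s t /\ ab_word t = word_pow v n.
  have t0 : 0 < size t by case: ct.
  have [t' et'] := ab_word_eq_pow t0 n1 ev.
  by exists t'; rewrite -et'.
have [|| [t [ct et]]] := insert_ab_word c elr; last first.
- by exists t, u; rewrite -et.
- move=> es; rewrite {}es in eu; have [v ev] := word_pow_eq_rcons eu.
  case: s s0 {elr eu} ev => // -[x y] s _ ev.
  by exists ((x.+1, y) :: s), v; split; first exact: code_insertion_a.
- move=> es; rewrite {}es in eu; have [v ev] := word_pow_eq_cons eu.
  case/lastP: s s0 {elr eu} ev => // s [x y] _ ev.
  exists (rcons s (x, y.+1)), v; split; first exact: code_insertion_last.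
  rewrite -ev -!cats1 !ab_word_cat !ab_word_cons -!catA -[y.+2]addn1 nseqD.
  by rewrite -!catA.
Qed.

(** * Codes of three pairs that become powers *)

Lemma word_pow_size3 (T : Type) (p q r : T) t n : 1 < n ->
  [:: p; q; r] = word_pow t n -> p = q /\ q = r.
Proof.
move=> n1 e; have := congr1 size e; rewrite size_word_pow.
case: t e => [|a [|b t]] e /=; [lia | move=> n3 | nia].
have n_eq : n = 3 by lia.
by move: e; rewrite n_eq => -[-> -> ->].
Qed.

(** The exponent is 2 or 4; both give period two. *)
Lemma word_pow_size4 (T : Type) (p q r s : T) t n : 1 < n ->
  [:: p; q; r; s] = word_pow t n -> p = r /\ q = s.
Proof.
move=> n1 e; have := congr1 size e; rewrite size_word_pow.
case: t e => [|a [|b [|c t]]] e /=; [lia | move=> n4 | move=> n2 | nia].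
  have n_eq : n = 4 by lia.
  by move: e; rewrite n_eq => -[-> -> -> ->].
have n_eq : n = 2 by lia.
by move: e; rewrite n_eq => -[-> -> -> ->].
Qed.

(* Splitting a run in two creates a run of length one, which cannot recur with
   the required period. *)
Lemma triple_code_insertion x1 y1 x2 y2 x3 y3 t n : 1 < n ->
  [&& 0 < x1, 0 < y1, 0 < x2, 0 < y2, 0 < x3 & 0 < y3] ->
  code_insertion [:: (x1, y1); (x2, y2); (x3, y3)] (word_pow t n) ->
  exists X Y, [&& x1 <= X, x2 <= X, x3 <= X, y1 <= Y, y2 <= Y, y3 <= Y &
    (x1 + x2 + x3 + (y1 + y2 + y3)).+1 == 3 * X + 3 * Y].
Proof.
move=> n1 pos; move et': (word_pow t n) => t' ct.
have H3 p q r : t' = [:: p; q; r] -> p = q /\ q = r.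
  by move=> e; apply: word_pow_size3 n1 (etrans (esym e) (esym et')).
have H4 p q r s : t' = [:: p; q; r; s] -> p = r /\ q = s.
  by move=> e; apply: word_pow_size4 n1 (etrans (esym e) (esym et')).
(* The insertion raises one entry to the value that the two others already have, so the common
   values are the maxima. *)
exists (maxn x1 (maxn x2 x3)), (maxn y1 (maxn y2 y3)).
move: pos H3 H4 => {et' n1 t n}.
inversion ct as [x y s|x y s|i j y s|x i j s|p s s' ct1]; subst => pos H3 H4;
  [| | | | inversion ct1 as [x y s|x y s|i j y s|x i j s|p s s1 ct2]; subst;
    [| | | | inversion ct2 as [x y s|x y s|i j y s|x i j s|p s s2 ct3]; subst;
      [| | | | inversion ct3]]].
(* Lengthening leaves three equal pairs; splitting gives four pairs of period two, equating the new
   0 with a positive entry. *)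
all: first [ have [[? ?] [? ?]] := H3 _ _ _ erefl
           | have [[? ?] [? ?]] := H4 _ _ _ _ erefl ]; lia.
Qed.

(** * The near-cube and the contradiction *)

Lemma insert_at_size (T : Type) (c : T) l r :
  insert_at (size l) c (l ++ r) = l ++ c :: r.
Proof. by rewrite /insert_at take_size_cat // drop_size_cat. Qed.

(** The code of a^k b^k a^k b^k a^(k-1) b^k with k = m+2. *)
Definition near_cube m : seq (nat * nat) :=
  [:: (m.+1, m.+1); (m.+1, m.+1); (m, m.+1)].

Lemma Q_I_bar_near_cube m : Q_I_bar (ab_word (near_cube m)).
Proof.
split.
  split=> // -[v [n [n1 e]]]; have [t et] := @ab_word_eq_pow (near_cube m) _ _ isT n1 e.
  by have [_ [em]] := word_pow_size3 n1 et; lia.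
pose q := (m.+1, m.+1).
have -> := ab_word_cat [:: q; q] [:: (m, m.+1)].
(* An a inserted after the second b-run completes the cube. *)
case=> _ /(_ (size (ab_word [:: q; q])) true).
rewrite insert_at_size size_cat leq_addr => -[] // _; apply.
exists (ab_word [:: q]), 3; split=> //.
by rewrite -ab_word_pow -(ab_word_cat [:: q; q] [:: (m.+1, m.+1)]).
Qed.

(** The condition on [X] and [Y] excludes the runs of (a^X b^Y)^3 with one letter missing; runs
    longer than one have positive codes, as [triple_code_insertion] requires. *)
Lemma Q_I_blocks f1 f2 f3 f4 f5 f6 :
  [&& 1 < f1, 1 < f2, 1 < f3, 1 < f4, 1 < f5 & 1 < f6] ->
  (forall X Y, ~ [&& f1 <= X, f3 <= X, f5 <= X, f2 <= Y, f4 <= Y, f6 <= Y &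
     (f1 + f3 + f5 + (f2 + f4 + f6)).+1 == 3 * X + 3 * Y]) ->
  primitive (blocks true [:: f1; f2; f3; f4; f5; f6]) ->
  Q_I (blocks true [:: f1; f2; f3; f4; f5; f6]).
Proof.
move=> pos nXY pr; split=> // i c _; split.
  by rewrite /insert_at; case: take.
move: pos nXY {pr}.
case: f1 f2 f3 f4 f5 f6 => [|x1] [|y1] [|x2] [|y2] [|x3] [|y3] pos nXY;
  try by exfalso; lia.
case=> u [n [n1 eu]].
have [t ct] := @insert_ab_word_eq_pow [:: (x1, y1); (x2, y2); (x3, y3)]
  _ _ _ _ _ isT n1 (cat_take_drop i _) eu.
have [X [Y XY]] := triple_code_insertion n1 pos ct.
(* Codes are run lengths minus one. *)
by apply: (nXY X.+1 Y.+1); lia.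
Qed.

Theorem theorem22 : ~ context_free (@Q_I_bar bool).
Proof.
(* All runs have length at least [pumping_length G + 3], hence at least 3 after the deletion. *)
case=> G eqG; pose m := pumping_length G + 2.
have /eqG lG := Q_I_bar_near_cube m.
have bE : ab_word (near_cube m) =
    blocks true [:: m.+2; m.+2; m.+2; m.+2; m.+1; m.+2] by [].
have szw : pumping_length G < size (ab_word (near_cube m)).
  by rewrite bE size_blocks /= /m; lia.
have [u [v [x [y [z [ew le_p gt0 /eqG[pr nQ]]]]]]] :
    exists u v x y z : seq bool,
    [/\ ab_word (near_cube m) = u ++ v ++ x ++ y ++ z,
      size (v ++ x ++ y) <= pumping_length G, 0 < size (v ++ y) &
      cfg_language G (u ++ x ++ z)] := cfg_pump_down lG szw.
have szE := congr1 size ew; rewrite bE size_blocks in szE; rewrite bE in ew.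
have [|fs [afs efs]] := delete_from_blocks (esym ew).
  by rewrite /= /m; lia.
have szF := congr1 size efs; rewrite size_blocks in szF.
rewrite !size_cat in szE szF le_p gt0.
have := adjacent_le_size afs.
case: fs afs efs szF => [|f1 [|f2 [|f3 [|f4 [|f5 [|f6 [|f7 fs]]]]]]] //.
rewrite [sumn _]/= [adjacent_le _ _]/= !eqseq_cons => afs efs szF _.
rewrite /= in szE; rewrite efs in pr nQ.
(* With k = m+2, some a-run and some b-run keep length k, so 3X+3Y is at least 6k; but at most 6k-2
   letters remain, and one insertion cannot reach 6k. *)
by apply: nQ; apply: Q_I_blocks pr => [|X Y]; rewrite /m in afs szE *; lia.
Qed.
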